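(* Let $\mathbb F$ be a field, $\epsilon\in\{0,1\}$, $k$ a positive integer, and $n=2k-1+\epsilon$. Let $\mathcal D\subseteq\mathrm{Mat}(k+\epsilon,\mathbb F)$ be an $\mathbb F$-linear subspace of dimension $k+\epsilon$ all of whose nonzero elements have rank $k+\epsilon$ (a $[(k+\epsilon)\times(k+\epsilon),k+\epsilon,k+\epsilon]_{\mathbb F}$ MRD code). Then $\mathcal C_{\mathcal D}:=\pi(\phi_{1,k}(\mathcal D))\subseteq\mathrm{U}(n,\mathbb F)$ has dimension $k+\epsilon$ and minimum flag-rank distance $k(k+\epsilon)$, and it is a maximum flag-rank distance (MFRD) code.
   Context: $\mathrm{U}(n,\mathbb F)$ is the space of $n\times n$ upper triangular matrices over $\mathbb F$. For $M\in\mathrm{U}(n,\mathbb F)$, $M_{[i]}$ is the submatrix with rows $1,\dots,i$ and columns $i,\dots,n$, and $\mathrm{w}_{\mathrm{fr}}(M)=\sum_{i=1}^n\operatorname{rk}(M_{[i]})$ is the flag-rank weight. A flag-rank-metric code is an $\mathbb F$-linear subspace $\mathcal C\subseteq\mathrm{U}(n,\mathbb F)$; an $\{n,t,\delta\}_{\mathbb F}$ code is one of dimension $t$ whose minimum flag-rank weight over nonzero elements is $\delta$. Let $g(\delta)=\delta-1+\lfloor\sqrt{\delta-1}\rfloor\cdot\lfloor(\sqrt{4(\delta-1)+1}-1)/2\rfloor$ and $f(n,\delta)=n(n+1)/2-g(\delta)$. A code is MFRD if it is an $\{n,f(n,\delta),\delta\}_{\mathbb F}$ code for some $\delta\ge1$.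 The map $\pi:\mathrm{Mat}(n,\mathbb F)\to\mathrm{U}(n,\mathbb F)$ sets all entries below the main diagonal to $0$ and keeps the others. For positive integers $\ell,i,j$ with $i+\ell-1\le n$, $j+\ell-1\le n$, $\phi_{i,j}:\mathrm{Mat}(\ell,\mathbb F)\to\mathrm{Mat}(n,\mathbb F)$ sends $M$ to the $n\times n$ matrix whose submatrix in rows $i,\dots,i+\ell-1$ and columns $j,\dots,j+\ell-1$ equals $M$, with all other entries $0$ (here $\ell=k+\epsilon$). *)

(* Defs.v *)
From HB Require Import structures.
From Stdlib Require Import Rdefinitions.
From mathcomp Require Import all_boot all_order all_algebra.
From mathcomp Require Import Rstruct.

Set Implicit Arguments.
Unset Strict Implicit.
Unset Printing Implicit Defensive.

Import Order.TTheory GRing.Theory Num.Theory.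
Local Open Scope ring_scope.

(* [is_trig_mx] is MathComp's predicate for lower triangular matrices. *)
Definition upper_triangular (F : fieldType) (n : nat) (M : 'M[F]_n) : bool :=
  is_trig_mx M^T.

Lemma flag_col_subproof (n : nat) (i : 'I_n) (c : 'I_(n - i)) : (i + c < n)%N.
Proof. by rewrite -ltn_subRL. Qed.

Definition flag_row (n : nat) (i : 'I_n) (r : 'I_i.+1) : 'I_n :=
  widen_ord (ltn_ord i) r.

Definition flag_col (n : nat) (i : 'I_n) (c : 'I_(n - i)) : 'I_n :=
  Ordinal (flag_col_subproof c).

(* Since i : 'I_n is 0-based, this is M_[i+1]: the first i+1 rows and the
   last n-i columns. *)
Definition flag_submx (F : fieldType) (n : nat) (M : 'M[F]_n) (i : 'I_n) :
    'M[F]_(i.+1, n - i) :=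
  mxsub (@flag_row n i) (@flag_col n i) M.

Definition flag_rank_weight (F : fieldType) (n : nat) (M : 'M[F]_n) : nat :=
  (\sum_(i < n) \rank (flag_submx M i))%N.

Definition flag_rank_code (F : fieldType) (n : nat) (C : {vspace 'M[F]_n}) :
    Prop :=
  forall M : 'M[F]_n, M \in C -> upper_triangular M.

(* In particular there is no such [delta] when C is the zero space. *)
Definition min_flag_rank_weight (F : fieldType) (n : nat)
    (C : {vspace 'M[F]_n}) (delta : nat) : Prop :=
  (exists M : 'M[F]_n, [/\ M \in C, M != 0 & flag_rank_weight M = delta]) /\
  (forall M : 'M[F]_n, M \in C -> M != 0 -> (delta <= flag_rank_weight M)%N).

Definition ntd_code (F : fieldType) (n : nat) (C : {vspace 'M[F]_n})
    (t delta : nat) : Prop :=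
  [/\ flag_rank_code C, \dim C = t & min_flag_rank_weight C delta].

(* Integer-valued, so that no subtraction is truncated. *)
Definition g (delta : nat) : int :=
  let d : R := delta%:R - 1 in
  (delta%:Z - 1) +
  Num.floor (Num.sqrt d) * Num.floor ((Num.sqrt (4 * d + 1) - 1) / 2).

Definition f (n delta : nat) : int := ((n * n.+1) %/ 2)%N%:Z - g delta.

Definition MFRD (F : fieldType) (n : nat) (C : {vspace 'M[F]_n}) : Prop :=
  exists (delta t : nat),
    [/\ (1 <= delta)%N, t%:Z = f n delta & ntd_code C t delta].

Definition pi_mx (F : fieldType) (n : nat) (M : 'M[F]_n) : 'M[F]_n :=
  \matrix_(i, j) if (j < i)%N then 0 else M i j.

Lemma pi_mx_is_linear (F : fieldType) (n : nat) : linear (@pi_mx F n).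
Proof.
by move=> a A B; apply/matrixP=> i j; rewrite !mxE; case: ifP => // _;
  rewrite mulr0 addr0.
Qed.

HB.instance Definition _ (F : fieldType) (n : nat) :=
  GRing.isLinear.Build F 'M[F]_n 'M[F]_n *:%R (@pi_mx F n)
    (@pi_mx_is_linear F n).

(* The positions i and j are 1-based, whereas the indices r, c, a, b are
   0-based: entry (a, b) of M is sent to entry (i - 1 + a, j - 1 + b); see
   [phi_mx_in] and [phi_mx_out]. *)
Definition phi_mx (F : fieldType) (l n i j : nat) (M : 'M[F]_l) : 'M[F]_n :=
  \matrix_(r < n, c < n)
    \sum_(a < l) \sum_(b < l)
      if (r.+1 == i + a)%N && (c.+1 == j + b)%N then M a b else 0.

Lemma phi_mx_is_linear (F : fieldType) (l n i j : nat) :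
  linear (@phi_mx F l n i j).
Proof.
move=> x A B; apply/matrixP=> r c; rewrite !mxE mulr_sumr -big_split /=.
apply: eq_bigr => a _; rewrite mulr_sumr -big_split /=.
by apply: eq_bigr => b _; case: ifP => _; rewrite ?mxE // mulr0 addr0.
Qed.

HB.instance Definition _ (F : fieldType) (l n i j : nat) :=
  GRing.isLinear.Build F 'M[F]_l 'M[F]_n *:%R (@phi_mx F l n i j)
    (@phi_mx_is_linear F l n i j).

Lemma phi_mx_in (F : fieldType) (l n i j : nat) (M : 'M[F]_l)
    (r c : 'I_n) (a b : 'I_l) :
  (r.+1 = i + a)%N -> (c.+1 = j + b)%N -> phi_mx n i j M r c = M a b.
Proof.
move=> hr hc; rewrite mxE (bigD1 a) //= (bigD1 b) //= hr hc !eqxx /=.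
rewrite big1 ?addr0 => [|b' nb]; last first.
  by rewrite eqn_add2l -(inj_eq val_inj) /= in nb *; rewrite eq_sym (negbTE nb).
rewrite big1 ?addr0 // => a' na; rewrite big1 // => b' _.
by rewrite eqn_add2l -(inj_eq val_inj) /= in na *; rewrite eq_sym (negbTE na).
Qed.

Lemma phi_mx_out (F : fieldType) (l n i j : nat) (M : 'M[F]_l) (r c : 'I_n) :
  ~~ [&& (i <= r.+1 < i + l)%N & (j <= c.+1 < j + l)%N] ->
  phi_mx n i j M r c = 0.
Proof.
move=> H; rewrite mxE big1 // => a _; rewrite big1 // => b _.
case: ifP => // /andP[/eqP ha /eqP hb]; move: H.
by rewrite ha hb !leq_addr !ltn_add2l !ltn_ord.
Qed.

Definition code_of (F : fieldType) (l n k : nat) (D : {vspace 'M[F]_l}) :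
    {vspace 'M[F]_n} :=
  (linfun (@pi_mx F n) @: (linfun (@phi_mx F l n 1 k) @: D))%VS.

(* Main.v *)
(** A nonzero element of the code carries an invertible matrix of order
    [l = k + eps] in rows [1..l] and columns [k..n], truncated in at most its
    lower left corner. For [i <= k], the flag submatrix [M_[i]] contains the
    first [i] rows of this matrix, untruncated; for [i > k] it contains its last
    [n - i + 1] columns, untruncated. Hence every [M_[i]] has the largest possible
    rank, and the weight is the sum of two triangular numbers, [k (k + eps)]. *)
Require Import Defs.
From mathcomp Require Import all_boot all_order all_algebra.
From mathcomp Require Import zify Rstruct.

Import Order.TTheory GRing.Theory Num.Theory.
Local Open Scope ring_scope.

Lemma mxrank_mxsub (F : fieldType) (m n p q : nat) (h : 'I_p -> 'I_m)
    (k : 'I_q -> 'I_n) (A : 'M[F]_(m, n)) : (\rank (mxsub h k A) <= \rank A)%N.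
Proof.
rewrite mxsubrc; apply: (leq_trans (mxrankS (rowsub_sub _ _))).
by rewrite -mxrank_tr -[leqRHS]mxrank_tr trmx_mxsub mxrankS ?rowsub_sub.
Qed.

(** Right multiplication by a row-free [A] preserves rank, so only the selection matrix
    [rowsub h 1%:M] matters; by injectivity its transpose is a right inverse. *)
Lemma mxrank_rowsub_free (F : fieldType) (m n p : nat) (h : 'I_p -> 'I_m)
    (A : 'M[F]_(m, n)) : injective h -> row_free A -> \rank (rowsub h A) = p.
Proof.
move=> h_inj freeA; rewrite rowsubE mxrankMfree //; apply/eqP.
apply/row_freeP; exists (colsub h 1%:M); apply/matrixP => i j.
by rewrite -rowsubE !mxE (inj_eq h_inj).
Qed.

Lemma mxrank_colsub_full (F : fieldType) (m n p : nat) (h : 'I_p -> 'I_n)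
    (A : 'M[F]_(m, n)) : injective h -> row_full A -> \rank (colsub h A) = p.
Proof.
move=> h_inj fullA; rewrite -mxrank_tr trmx_mxsub mxrank_rowsub_free //.
by rewrite /row_free mxrank_tr.
Qed.

Lemma pi_phi_mxE (F : fieldType) (l n k : nat) (M : 'M[F]_l) (r c : 'I_n)
    (a b : 'I_l) :
  r = a :> nat -> c.+1 = (k + b)%N -> (r <= c)%N ->
  pi_mx (phi_mx n 1 k M) r c = M a b.
Proof.
by move=> ra cb rc; rewrite mxE ltnNge rc; apply: phi_mx_in; rewrite ?ra.
Qed.

Lemma mxrank_flag_submx_pi_phi (F : fieldType) (l n k : nat) (M : 'M[F]_l)
    (i : 'I_n) :
  (k <= l <= k.+1)%N -> n.+1 = (k + l)%N -> M \in unitmx ->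
  \rank (flag_submx (pi_mx (phi_mx n 1 k M)) i) =
  (if i < k then i.+1 else n - i)%N.
Proof.
move=> kl nkl Mu; set A := flag_submx _ i; have lt_in := ltn_ord i.
case: ifPn => ik; apply/eqP; rewrite eqn_leq.
  have le_il : (i.+1 <= l)%N by lia.
  (* Column [b] of [M] lands in 0-based column [k.-1 + b], and the columns of [A] start at [i],
     which is at most [k.-1] here. *)
  have lt_h (b : 'I_l) : (k.-1 + b - i < n - i)%N by have := ltn_ord b; lia.
  rewrite rank_leq_row /=.
  rewrite -{1}(@mxrank_rowsub_free _ _ _ _ (widen_ord le_il) M); first last.
  - by rewrite row_free_unit.
  - by move=> x y /(congr1 val) /= /val_inj.
  suff -> : rowsub (widen_ord le_il) M = colsub (fun b => Ordinal (lt_h b)) A.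
    exact: mxrank_mxsub.
  apply/matrixP => r b; rewrite mxE [RHS]mxE mxE.
  have := ltn_ord r; have := ltn_ord b.
  by move=> lt_b lt_r; apply/esym/pi_phi_mxE => //=; lia.
(* Now [k <= i], so [l <= k.+1] ensures that [A] meets all [l] rows of [M]. Its column [c] is column
   [i + c - k.-1] of [M]. *)
have le_li : (l <= i.+1)%N by lia.
have lt_h (c : 'I_(n - i)) : (i + c - k.-1 < l)%N by have := ltn_ord c; lia.
rewrite rank_leq_col /=.
rewrite -{1}(@mxrank_colsub_full _ _ _ _ (fun c => Ordinal (lt_h c)) M); first last.
- by rewrite row_full_unit.
- by move=> x y /(congr1 val) /= xy; apply/val_inj => /=; lia.
suff -> : colsub (fun c => Ordinal (lt_h c)) M = rowsub (widen_ord le_li) A.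
  exact: mxrank_mxsub.
apply/matrixP => a c; rewrite mxE [RHS]mxE mxE.
have := ltn_ord a; have := ltn_ord c.
by move=> lt_c lt_a; apply/esym/pi_phi_mxE => //=; lia.
Qed.

Lemma sum_ord_succ (m : nat) : (\sum_(i < m) i.+1 = 'C(m.+1, 2))%N.
Proof. by rewrite -bin2_sum big_mkord big_ord_recl. Qed.

Lemma flag_rank_weight_pi_phi (F : fieldType) (l n k : nat) (M : 'M[F]_l) :
  (k <= l <= k.+1)%N -> n.+1 = (k + l)%N -> M \in unitmx ->
  flag_rank_weight (pi_mx (phi_mx n 1 k M)) = ('C(k.+1, 2) + 'C(l, 2))%N.
Proof.
move=> kl nkl Mu; rewrite /flag_rank_weight.
under eq_bigr => i _ do rewrite mxrank_flag_submx_pi_phi //.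
case: l => [|l] in kl nkl M Mu *; first by case: k n kl nkl M Mu => [|k] [|n].
have {nkl} -> : n = (k + l)%N by lia.
rewrite big_split_ord /= -!sum_ord_succ; congr addn.
  by apply: eq_bigr => i _; rewrite ltn_ord.
(* The remaining ranks [l - i] decrease to 1; reversal turns them into [i.+1]. *)
rewrite (reindex_inj rev_ord_inj) /=; apply: eq_bigr => i _.
by have := ltn_ord i; case: ifP; lia.
Qed.

Lemma flag_rank_weight0 (F : fieldType) (n : nat) :
  flag_rank_weight (0 : 'M[F]_n) = 0%N.
Proof.
rewrite /flag_rank_weight big1 // => i _.
by rewrite (_ : flag_submx 0 i = 0) ?mxrank0 //; apply/matrixP => r c; rewrite !mxE.
Qed.

Lemma natr_le_sqrt (R : rcfType) (m d : nat) :
  (m%:R <= Num.sqrt d%:R :> R) = (m ^ 2 <= d)%N.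
Proof.
by rewrite -[m%:R]ger0_norm ?ler0n // -sqrtr_sqr ler_sqrt ?ler0n // -natrX ler_nat.
Qed.

Lemma floor_sqrt_nat (m d : nat) :
  (m ^ 2 <= d < m.+1 ^ 2)%N ->
  Num.floor (Num.sqrt d%:R : Rdefinitions.R) = m%:Z.
Proof.
move=> /andP[lo hi]; apply: floor_def.
by rewrite -PoszD addn1 -!pmulrn ltNge !natr_le_sqrt lo -ltnNge.
Qed.

(** Since [(2m + 1)^2 = 4m(m + 1) + 1], this floor is the largest [m] with [m(m + 1) <= d]. *)
Lemma floor_half_sqrt_nat (m d : nat) :
  (m * m.+1 <= d < m.+1 * m.+2)%N ->
  Num.floor ((Num.sqrt (4 * d%:R + 1) - 1) / 2 : Rdefinitions.R) = m%:Z.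
Proof.
move=> /andP[lo hi]; apply: floor_def.
have -> : 4 * d%:R + 1 = (4 * d + 1)%N%:R :> Rdefinitions.R.
  by rewrite natrD natrM.
have lo' : (m * 2 + 1)%:R <= Num.sqrt (4 * d + 1)%N%:R :> Rdefinitions.R.
  by rewrite natr_le_sqrt; nia.
have hi' : Num.sqrt (4 * d + 1)%N%:R < ((m + 1) * 2 + 1)%:R :> Rdefinitions.R.
  by rewrite ltNge natr_le_sqrt -ltnNge; nia.
rewrite -PoszD -!pmulrn ler_pdivlMr ?ltr_pdivrMr ?ltr0n //.
by rewrite lerBrDr ltrBlDr -!natrM -!(natrD _ _ 1) lo' hi'.
Qed.

Lemma g_succ (a b d : nat) :
  (a ^ 2 <= d < a.+1 ^ 2)%N -> (b * b.+1 <= d < b.+1 * b.+2)%N ->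
  g d.+1 = (d + a * b)%N%:Z.
Proof.
move=> ha hb; rewrite /g -natr1 addrK (@floor_sqrt_nat a) //.
by rewrite (@floor_half_sqrt_nat b) //; lia.
Qed.

Lemma f_pronic (eps k : nat) :
  eps = 0%N \/ eps = 1%N -> (0 < k)%N ->
  f (2 * k - 1 + eps) (k * (k + eps)) = (k + eps)%N%:Z.
Proof.
move=> heps; case: k => // k _; rewrite /f.
have -> : (k.+1 * (k.+1 + eps) = (k.+1 * (k.+1 + eps)).-1.+1)%N by lia.
(* With [k] now the predecessor of the original one, the argument of both floors is
   [(k + 1)(k + 1 + eps) - 1]: one below a square if [eps = 0], one below a pronic number if
   [eps = 1]. This forces the values [k + eps] and [k]. *)
rewrite (@g_succ (k + eps) k); [|case: heps => ->; nia..].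
have -> : ((2 * k.+1 - 1 + eps) * (2 * k.+1 - 1 + eps).+1 %/ 2)%N
    = (k.+1 * (2 * k + 1) + eps * (2 * k.+1))%N.
  by rewrite (_ : _ * _ = (k.+1 * (2 * k + 1) + eps * (2 * k.+1)) * 2)%N ?mulnK //;
    case: heps => ->; nia.
by case: heps => ->; nia.
Qed.

Lemma mem_code_of (F : fieldType) (l n k : nat) (D : {vspace 'M[F]_l})
    (N : 'M[F]_n) :
  reflect (exists2 M, M \in D & N = pi_mx (phi_mx n 1 k M)) (N \in code_of n k D).
Proof.
rewrite /code_of -limg_comp; apply: (iffP memv_imgP) => -[M MD ->];
  by exists M; rewrite // lfunE /= !lfunE.
Qed.

Lemma ntd_code_of (F : fieldType) (l n k : nat) (D : {vspace 'M[F]_l}) :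
  (0 < k)%N -> (k <= l <= k.+1)%N -> n.+1 = (k + l)%N -> \dim D = l ->
  (forall M, M \in D -> M != 0 -> \rank M = l) ->
  ntd_code (code_of n k D) l ('C(k.+1, 2) + 'C(l, 2)).
Proof.
move=> k_gt0 kl nkl dimD rankD.
have weightD M : M \in D -> M != 0 ->
    flag_rank_weight (pi_mx (phi_mx n 1 k M)) = ('C(k.+1, 2) + 'C(l, 2))%N.
  move=> MD M_neq0; apply: flag_rank_weight_pi_phi => //.
  by rewrite -row_free_unit /row_free rankD.
(* Injectivity on [D] is read off the weight: it is positive on images of nonzero elements, but 0 on
   the zero matrix. *)
have injD M : M \in D -> M != 0 -> pi_mx (phi_mx n 1 k M) != 0.
  move=> MD M_neq0; apply/eqP => E0; have := weightD M MD M_neq0.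
  by rewrite E0 flag_rank_weight0; have := @bin_gt0 k.+1 2; lia.
split.
- move=> _ /mem_code_of[M _ ->]; apply/is_trig_mxP => i j ij.
  by rewrite !mxE ij.
- rewrite /code_of -limg_comp limg_dim_eq //; apply/eqP.
  rewrite -subv0; apply/subvP => M; rewrite memv_cap memv_ker memv0.
  case/andP=> MD; rewrite lfunE /= !lfunE /=; apply: contraLR.
  exact: injD.
split=> [|_ /mem_code_of[M MD ->] E_neq0]; last first.
  by rewrite weightD //; apply: contraNneq E_neq0 => ->; rewrite !linear0.
(* All nonzero codewords have the same weight, so any nonzero element of [D] attains the minimum. *)
have D_neq0 : D != 0%VS by rewrite -dimv_eq0 dimD; lia.
have MD := memv_pick D; have M_neq0 : vpick D != 0 by rewrite vpick0.
exists (pi_mx (phi_mx n 1 k (vpick D))); split; [|exact: injD|exact: weightD].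
by apply/mem_code_of; exists (vpick D).
Qed.

Theorem theorem4p6 (F : fieldType) (eps k n : nat)
    (heps : eps = 0%N \/ eps = 1%N)
    (hk : (0 < k)%N)
    (hn : n = (2 * k - 1 + eps)%N)
    (D : {vspace 'M[F]_(k + eps)})
    (hdim : \dim D = (k + eps)%N)
    (hrank : forall M : 'M[F]_(k + eps),
        M \in D -> M != 0 -> \rank M = (k + eps)%N) :
  ntd_code (code_of n k D) (k + eps) (k * (k + eps)) /\
  MFRD (code_of n k D).
Proof.
have weightE : ('C(k.+1, 2) + 'C(k + eps, 2) = k * (k + eps))%N.
  (* These give [2 'C(m, 2) = m(m - 1)]; the doubled sum is [2k(k + eps)] because [eps^2 = eps]. *)
  have := mul_bin_diag k.+1 1; have := mul_bin_diag (k + eps) 1.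
  by rewrite !bin1 /=; case: heps => ->; rewrite ?addn0 ?addn1; nia.
have codeD : ntd_code (code_of n k D) (k + eps) (k * (k + eps)).
  by rewrite -weightE; apply: ntd_code_of => //; lia.
split=> //; exists (k * (k + eps))%N, (k + eps)%N; split=> //; first by nia.
by rewrite hn f_pronic.
Qed.
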